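(* Let $\mathcal{U}$ be a summable set such that $\mathbb{C}[x]\subset\mathbf{S}(\mathcal{U})$ and let $P\in\mathbb{C}[x]$. Then, for all $x\in\mathbb{C}$, $$\Sigma_{\mathcal{U}}(P;1,x)=\int_0^x P(t)\,dt+\frac{P(x)-P(0)}{2}+\sum_{m=1}^\infty\frac{B_{2m}}{(2m)!}\bigl(P^{(2m-1)}(x)-P^{(2m-1)}(0)\bigr),$$ where $B_{2m}$ are the Bernoulli numbers.
   Context: $\mathbb{C}[x]$ denotes the set of complex polynomials, viewed as functions $\mathbb{C}\to\mathbb{C}$. Sets of functions. $\mathbb{C}^{\mathbb{C}}$ is the set of all functions $\mathbb{C}\to\mathbb{C}$. For $X\subset\mathbb{C}^{\mathbb{C}}$: $\mathbf{L}(X)$ is the set of all (finite, complex) linear combinations of functions in $X$; $\mathbf{T}(X)$ is the set of all translates $x\mapsto g(x+c)$ with $g\in X$, $c\in\mathbb{C}$; and $\mathbf{S}(X):=\mathbf{L}(\mathbf{T}(X))$. Polynomial sums. For a complex polynomial $p$, let $P$ be the unique polynomial with $P(z)-P(z-1)=p(z)$ for all $z$ and $P(0)=0$; the fractional sum of $p$ from $x$ to $y$ is $P(y)-P(x-1)$, for $x,y\in\mathbb{C}$ (this letter $P$ is local to this paragraph). Fractional summable functions. $f:\mathbb{C}\to\mathbb{C}$ is fractional summable if there are a degree bound $m$ and a sequence $(p_n)_{n\in\mathbb{N}}$ of polynomials of degree $\le m$ (the null polynomial has degree $-\infty$) such that $|f(n+x)-p_n(n+x)|\to 0$ as $n\to\infty$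 for all $x\in\mathbb{C}$, and such that for all $x,y\in\mathbb{C}$ the limit as $n\to\infty$ of (fractional sum of $p_n$ from $n+x$ to $n+y$) $+\sum_{\nu=1}^n\bigl(f(\nu+x-1)-f(\nu+y)\bigr)$ exists. $\mathcal{F}$ is the set of functions $\mathbb{C}\to\mathbb{C}$ that are linear combinations of holomorphic (entire) functions and fractional summable functions. Summable sets. A set $\mathcal{U}\subset\mathcal{F}$ is a summable set if there is a unique map $\Sigma_{\mathcal{U}}:\mathbf{S}(\mathcal{U})\times\mathbb{C}^2\to\mathbb{C}$, $(f,x,y)\mapsto\Sigma_{\mathcal{U}}(f;x,y)$ (thought of as ''$\sum_{k=x}^y f(k)$''), satisfying, for all $f,g\in\mathbf{S}(\mathcal{U})$ and $x,y,z,s,\lambda,\mu\in\mathbb{C}$: (A1) $\Sigma_{\mathcal{U}}(f;x,y)+\Sigma_{\mathcal{U}}(f;y+1,z)=\Sigma_{\mathcal{U}}(f;x,z)$; (A2) $\Sigma_{\mathcal{U}}(f;x+s,y+s)=\Sigma_{\mathcal{U}}(h;x,y)$ where $h(t)=f(t+s)$; (A3) $\Sigma_{\mathcal{U}}(\lambda f+\mu g;x,y)=\lambda\Sigma_{\mathcal{U}}(f;x,y)+\mu\Sigma_{\mathcal{U}}(g;x,y)$; (A4) $\Sigma_{\mathcal{U}}(f;1,1)=f(1)$; (A5* ) if $f$ is holomorphic, then $x\mapsto\Sigma_{\mathcal{U}}(f;1,x)$ is holomorphic on $\mathbb{C}$; (A6) if $\lim_{n\to\infty}f(t+n)=0$ for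 every $t\in\mathbb{C}$, then $\lim_{n\to\infty}\Sigma_{\mathcal{U}}(f(\cdot+n);x,y)=0$; moreover, if there is a sequence $(p_n)$ of polynomials of fixed degree (independent of $n$) with $|f(t+n)-p_n(t+n)|\to0$ for all $t\in\mathbb{C}$, then $\Sigma_{\mathcal{U}}(f(\cdot+n);x,y)$ minus the fractional sum of the polynomial $p_n(\cdot+n)$ from $x$ to $y$ tends to $0$ as $n\to\infty$. The map $\Sigma_{\mathcal{U}}$ is called the fractional sum relative to $\mathcal{U}$. *)

(* Defs.v *)
From HB Require Import structures.
From mathcomp Require Import all_boot all_order all_algebra.
From mathcomp Require Import all_classical all_reals all_analysis.
From mathcomp Require Import complex.

Set Implicit Arguments.
Unset Strict Implicit.
Unset Printing Implicit Defensive.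

Import Order.TTheory GRing.Theory Num.Theory.
Import numFieldNormedType.Exports.

Local Open Scope classical_set_scope.
Local Open Scope ring_scope.

(* MathComp-Analysis infers the topology of C from its numFieldType
   structure, which the bare type R[i] does not expose. *)
Definition Cplx (R : realType) : numFieldType := R[i].

Section Defs.
Variable R : realType.
Local Notation C := (Cplx R).
Implicit Types (f g : C -> C) (X U : set (C -> C)) (p : {poly C}).

Definition entire f : Prop := forall z : C, derivable f z 1.

Definition polynomial_functions : set (C -> C) :=
  range (fun p : {poly C} => horner p).

Definition linear_combinations X : set (C -> C) :=
  [set f | exists (n : nat) (a : 'I_n -> C) (g : 'I_n -> C -> C),
     (forall i, X (g i)) /\ f = (fun z => \sum_(i < n) a i * g i z)].

Definition translates X : set (C -> C) :=
  [set f | exists (g : C -> C) (c : C), X g /\ f = (fun z => g (z + c))].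

Definition S_span X : set (C -> C) := linear_combinations (translates X).

Definition is_poly_sum p (P : {poly C}) : Prop :=
  (forall z : C, P.[z] - P.[z - 1] = p.[z]) /\ P.[0] = 0.

(* The default value 0 is never used: every p has exactly one such P. *)
Definition poly_sum p : {poly C} := xget 0 [set P | is_poly_sum p P].

Definition poly_frac_sum p (x y : C) : C :=
  (poly_sum p).[y] - (poly_sum p).[x - 1].

Definition fractional_summable f : Prop :=
  exists (m : nat) (p : nat -> {poly C}),
  [/\ forall n, (size (p n) <= m.+1)%N,
      forall x : C, `|f (n%:R + x) - (p n).[n%:R + x]| @[n --> \oo] --> (0 : C)
    & forall x y : C, cvgn (fun n : nat =>
        poly_frac_sum (p n) (n%:R + x) (n%:R + y)
        + \sum_(1 <= k < n.+1) (f (k%:R + x - 1) - f (k%:R + y)))].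

Definition F_class : set (C -> C) :=
  linear_combinations [set f | entire f \/ fractional_summable f].

(* A map S(U) * C^2 -> C is given as a total map on (C -> C) * C * C whose
   values outside S(U) are irrelevant. *)
Record is_fractional_sum U (Sig : (C -> C) -> C -> C -> C) : Prop := {
  frac_sum_chasles : forall f, S_span U f -> forall x y z : C,
    Sig f x y + Sig f (y + 1) z = Sig f x z;
  frac_sum_shift : forall f, S_span U f -> forall x y s : C,
    Sig f (x + s) (y + s) = Sig (fun t => f (t + s)) x y;
  frac_sum_linear : forall f g, S_span U f -> S_span U g ->
    forall lambda mu x y : C,
    Sig (fun t => lambda * f t + mu * g t) x y
      = lambda * Sig f x y + mu * Sig g x y;
  frac_sum_one : forall f, S_span U f -> Sig f 1 1 = f 1;
  frac_sum_entire : forall f, S_span U f ->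
    entire f -> entire (fun x => Sig f 1 x);
  frac_sum_asympt0 : forall f, S_span U f ->
    (forall t : C, f (t + n%:R) @[n --> \oo] --> (0 : C)) ->
    forall x y : C,
      Sig (fun t => f (t + n%:R)) x y @[n --> \oo] --> (0 : C);
  frac_sum_asympt : forall f, S_span U f ->
    forall (d : nat) (p : nat -> {poly C}),
    (forall n, size (p n) = d) ->
    (forall t : C,
      `|f (t + n%:R) - (p n).[t + n%:R]| @[n --> \oo] --> (0 : C)) ->
    forall x y : C,
      Sig (fun t => f (t + n%:R)) x y
        - poly_frac_sum (p n \Po ('X + (n%:R)%:P)) x y
        @[n --> \oo] --> (0 : C)
}.

Definition summable_set U : Prop :=
  U `<=` F_class /\
  exists Sig, is_fractional_sum U Sig /\
    forall Sig', is_fractional_sum U Sig' ->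
      forall f, S_span U f -> forall x y : C, Sig' f x y = Sig f x y.

(* Integral along the segment t |-> a + t (b - a), 0 <= t <= 1. *)
Definition segment_integral f (a b : C) : C :=
  let h (t : R) : C := f (a + (t%:C)%C * (b - a)) * (b - a) in
  ((\int[lebesgue_measure]_(t in `[0%R, 1%R]) complex.Re (h t))%R
   +i* (\int[lebesgue_measure]_(t in `[0%R, 1%R]) complex.Im (h t))%R)%C.

End Defs.

(* [:: B_0; ...; B_(n-1)], from \sum_(k <= n) 'C(n.+1, k) B_k = (n == 0)%:R. *)
Fixpoint bernoulli_seq (n : nat) : seq rat :=
  if n is m.+1 then
    let s := bernoulli_seq m in
    rcons s (((m == 0%N)%:R - \sum_(k < m) 'C(m.+1, k)%:R * s`_k) / m.+1%:R)
  else [::].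

Definition bernoulli_number (n : nat) : rat := (bernoulli_seq n.+1)`_n.

(* Main.v *)
(* Let S be the summation polynomial of P, with S(z) - S(z - 1) = P(z) and
   S(0) = 0.  The function Sigma(P; 1, .) - S is 1-periodic and vanishes at 0,
   and axiom (A6), applied to the translates of P, which are asymptotic to
   themselves, makes it constant; so Sigma(P; 1, .) = S.  That S is given by the
   Euler-Maclaurin formula is the identity (e^D - 1) (D / (e^D - 1)) = D applied
   to a primitive of P, where e^D is the unit translation and
   D / (e^D - 1) = \sum_j B_j D^j / j!; passing from S(z + 1) - S(z) = P(z) to
   S(z) - S(z - 1) = P(z) adds P and turns B_1 = - 1/2 into 1/2. *)
Require Import Defs.
From HB Require Import structures.
From mathcomp Require Import all_boot all_order all_algebra.
From mathcomp Require Import all_classical all_reals all_analysis.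
From mathcomp Require Import complex ring.

Set Implicit Arguments.
Unset Strict Implicit.
Unset Printing Implicit Defensive.

Import Order.TTheory GRing.Theory Num.Theory.
Import numFieldNormedType.Exports.

Local Open Scope classical_set_scope.
Local Open Scope ring_scope.

Local Notation B := bernoulli_number.

(** * Bernoulli numbers: recurrence and vanishing at odd indices *)

Lemma size_bernoulli_seq n : size (bernoulli_seq n) = n.
Proof. by elim: n => //= n IH; rewrite size_rcons IH. Qed.

Lemma nth_bernoulli_seq n k : (k < n)%N -> (bernoulli_seq n)`_k = B k.
Proof.
elim: n => // n IH; rewrite ltnS leq_eqVlt => /predU1P[->//|kn].
by rewrite /= nth_rcons size_bernoulli_seq kn IH.
Qed.

Lemma bernoulli_numberE n :
  B n = ((n == 0%N)%:R - \sum_(k < n) 'C(n.+1, k)%:R * B k) / n.+1%:R.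
Proof.
rewrite /B /= nth_rcons size_bernoulli_seq ltnn eqxx.
by under eq_bigr => k _ do rewrite nth_bernoulli_seq //.
Qed.

Lemma sum_bin_bernoulli n :
  \sum_(k < n) 'C(n, k)%:R * B k = (n == 1%N)%:R.
Proof.
case: n => [|n]; first by rewrite big_ord0.
rewrite big_ord_recr /= binSn [in B n]bernoulli_numberE eqSS mulrC.
by rewrite divfK ?pnatr_eq0 // addrC subrK.
Qed.

Lemma bernoulli_number0 : B 0 = 1.
Proof.
have := sum_bin_bernoulli 1.
by rewrite big_ord_recr big_ord0 /= add0r (_ : 'C(1, 0) = 1%N) // mul1r.
Qed.

Lemma bernoulli_number1 : B 1 = - (1 / 2).
Proof.
have := sum_bin_bernoulli 2; rewrite !big_ord_recr big_ord0 /=.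
rewrite (_ : 'C(2, 0) = 1%N) // (_ : 'C(2, 1) = 2%N) // bernoulli_number0.
rewrite add0r mul1r => h.
by apply: (@mulfI _ 2%:R) => //; rewrite -[LHS](addKr 1) h.
Qed.

(** The relation at [n.+1] carries [c n] with the nonzero coefficient [n.+1], so it determines [c n]
    from the earlier values. *)
Lemma bernoulli_seq_unique (c : nat -> rat) :
  (forall n, \sum_(k < n) 'C(n, k)%:R * c k = (n == 1%N)%:R) -> c =1 B.
Proof.
move=> hc n; elim/ltn_ind: n => n IH.
have := hc n.+1; rewrite -(sum_bin_bernoulli n.+1) !big_ord_recr /=.
under eq_bigr => k _ do rewrite IH //.
by move/addrI/mulfI; apply; rewrite pnatr_eq0 binSn.
Qed.

Lemma coefD1Xn (K : comNzRingType) n k :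
  (('X + 1 : {poly K}) ^+ n)`_k = 'C(n, k)%:R.
Proof.
rewrite exprD1n coef_sum.
have [kn|nk] := ltnP k n.+1.
  rewrite (bigD1 (Ordinal kn)) //= coefMn coefXn eqxx big1 ?addr0 // => i ik.
  by rewrite coefMn coefXn eq_sym (_ : _ == _ = false) ?mul0rn //; exact/negbTE.
rewrite bin_small // big1 // => i _.
by rewrite coefMn coefXn gtn_eqF ?mul0rn // (leq_trans (ltn_ord i)).
Qed.

Lemma sum_bin_bernoulli_full n :
  \sum_(k < n.+1) 'C(n, k)%:R * B k = B n + (n == 1%N)%:R.
Proof. by rewrite big_ord_recr /= binn mul1r sum_bin_bernoulli addrC. Qed.

(* Binomial inversion: apply the functional X^k |-> B_k to
   X^n = ((X + 1) - 1)^n. *)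
Lemma sum_bin_bernoulli_alt n :
  \sum_(j < n.+1) 'C(n, j)%:R * ((-1) ^+ j * (B j + (j == 1 :> nat)%:R))
    = (-1) ^+ n * B n.
Proof.
pose L (p : {poly rat}) := \sum_(k < n.+1) p`_k * B k.
have LX j : (j <= n)%N -> L (('X + 1) ^+ j) = B j + (j == 1%N)%:R.
  move=> jn; rewrite -sum_bin_bernoulli_full /L.
  rewrite (big_ord_widen n.+1 (fun k => 'C(j, k)%:R * B k)) //.
  rewrite [RHS]big_mkcond; apply: eq_bigr => k _.
  by rewrite coefD1Xn; case: ltnP => // jk; rewrite bin_small ?mul0r.
have -> : B n = L 'X^n.
  rewrite /L big_ord_recr /= coefXn eqxx mul1r big1 ?add0r // => k _.
  by rewrite coefXn ltn_eqF ?mul0r.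
have -> : 'X^n = \sum_(j < n.+1)
    ((-1) ^+ (n - j) * 'C(n, j)%:R) *: ('X + 1 : {poly rat}) ^+ j.
  rewrite -[in LHS](addKr 1 'X) (addrC 1) exprDn; apply: eq_bigr => j _.
  have -> : (-1) ^+ (n - j) = ((-1) ^+ (n - j))%:P :> {poly rat}.
    by rewrite rmorphXn rmorphN1.
  by rewrite mul_polyC -scaler_nat scalerA mulrC.
rewrite /L.
under [X in _ = _ * X]eq_bigr => k _ do rewrite coef_sum mulr_suml.
rewrite exchange_big mulr_sumr; apply: eq_bigr => j _ /=.
under [X in _ = _ * X]eq_bigr => k _ do rewrite coefZ -mulrA.
rewrite -mulr_sumr -/(L _) LX ?(ltnSE (ltn_ord j)) // !mulrA; congr (_ * _).
rewrite mulrC; congr (_ * _).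
rewrite exprB ?unitrN1 ?(ltnSE (ltn_ord j)) // invr_sign
  mulrA -expr2 sqrr_sign.
by rewrite mul1r.
Qed.

(** By binomial inversion, $(-1)^j (B_j + [j = 1])$ satisfies the recurrence that characterises the
    Bernoulli numbers, hence equals $B_j$. At an odd index above 1 this reads $-B_n = B_n$. *)
Lemma bernoulli_number_odd n : odd n -> (1 < n)%N -> B n = 0.
Proof.
move=> oddn n1.
pose c j := (-1) ^+ j * (B j + (j == 1%N)%:R).
have /bernoulli_seq_unique/(_ n) : forall m,
    \sum_(k < m) 'C(m, k)%:R * c k = (m == 1%N)%:R.
  move=> m; have := sum_bin_bernoulli_alt m.
  rewrite big_ord_recr /= binn mul1r mulrDr.
  have -> : (-1) ^+ m * (m == 1%N)%:R = - (m == 1%N)%:R :> rat.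
    by case: eqP => [->|]; rewrite ?expr1 ?mulN1r // mulr0 oppr0.
  by move=> /(canRL (addrK _)) ->; rewrite opprD opprK addrA subrr add0r.
rewrite /c -signr_odd oddn expr1 gtn_eqF // addr0 mulN1r => /esym/eqP.
by rewrite -addr_eq0 -mulr2n mulrn_eq0 /= => /eqP.
Qed.

(** Regroups a truncated Cauchy product by total order [n = j + k]; pairs of the square outside the
    triangle contribute nothing. *)
Lemma sum_triangle (V : nmodType) (g : nat -> nat -> V) N :
  (forall j k, (N <= j + k)%N -> g j k = 0) ->
  \sum_(j < N) \sum_(k < N) g j k = \sum_(n < N) \sum_(j < n.+1) g j (n - j)%N.
Proof.
move=> g0.
under [RHS]eq_bigr => n _ do
  rewrite (big_ord_widen N (fun j => g j (n - j)%N)) //.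
rewrite [RHS](exchange_big_dep xpredT) //=; apply: eq_bigr => j _.
rewrite -(big_geq_mkord j N xpredT (fun n => g j (n - j)%N)).
rewrite -[X in index_iota X N](add0n j) big_addn -(big_mkord xpredT (g j)).
rewrite (big_cat_nat _ (leq_subr j N)) //= [X in _ + X]big_nat_cond.
rewrite [X in _ + X]big1 ?addr0 => [|k /andP[/andP[Nk _] _]].
  by apply: eq_bigr => k _; rewrite addnK.
by apply: g0; rewrite -leq_subLR.
Qed.

(** * Euler-Maclaurin summation of polynomials *)

Section EulerMaclaurin.
Variable K : numFieldType.
Implicit Types (p P J : {poly K}) (z : K).

Lemma horner_taylor1 p N z : (size p <= N)%N ->
  p.[z + 1] = \sum_(k < N) p^`(k).[z] / k`!%:R.
Proof.
move=> pN; rewrite (nderiv_taylor_wide (mulrC _ _) pN); apply: eq_bigr => k _.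
rewrite expr1n mulr1 nderivn_def hornerMn -[_ *+ _]mulr_natr.
by rewrite mulfK // pnatr_eq0 -lt0n fact_gt0.
Qed.

(* D / (e^D - 1), up to derivatives of order at least N. *)
Definition bernoulli_operator N J : {poly K} :=
  \sum_(j < N) (ratr (B j) / j`!%:R) *: J^`(j).

(** Taylor expansion of each translated derivative gives a double sum, which is grouped by the total
    order $m$ of differentiation. The coefficient of $J^{(m)}$ is then $(B_m + [m = 1]) / m!$, and
    subtracting the untranslated operator leaves only $m = 1$. *)
Lemma bernoulli_operator_diff N J z : (1 < N)%N -> (size J <= N)%N ->
  (bernoulli_operator N J).[z + 1] - (bernoulli_operator N J).[z] = J^`().[z].
Proof.
move=> N1 JN.
have factK n : n`!%:R != 0 :> K by rewrite pnatr_eq0 -lt0n fact_gt0.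
have Jd j : (size J^`(j) <= N)%N.
  apply/leq_sizeP => i Ni; rewrite coef_derivn nth_default ?mul0rn //.
  exact: leq_trans JN (leq_trans Ni (leq_addl _ _)).
rewrite /bernoulli_operator !horner_sum.
under eq_bigr => j _ do rewrite hornerZ (horner_taylor1 z (Jd j)) mulr_sumr.
pose g j k := ratr (B j) / j`!%:R * (J^`(j + k).[z] / k`!%:R).
rewrite (eq_bigr (fun j : 'I_N => \sum_(k < N) g j k)); last first.
  by move=> j _; apply: eq_bigr => k _; rewrite /g /derivn addnC iterD.
rewrite sum_triangle => [|j k Njk]; last first.
  by rewrite /g derivn_poly0 ?(leq_trans JN) // horner0 mul0r mulr0.
(* Since $1 / (j! (m - j)!) = C(m, j) / m!$, the diagonal is a full binomial sum of Bernoulli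
   numbers. *)
have inner m : \sum_(j < m.+1) g j (m - j)%N
    = (ratr (B m) + (m == 1%N)%:R) / m`!%:R * J^`(m).[z].
  rewrite -[(m == 1%N)%:R](@ratr_nat K) -rmorphD -sum_bin_bernoulli_full.
  rewrite rmorph_sum !mulr_suml; apply: eq_bigr => j _.
  have jm : (j <= m)%N := ltnSE (ltn_ord j).
  rewrite /g subnKC // rmorphM /= ratr_nat -(bin_fact jm) !natrM.
  have := factK j; have := factK (m - j)%N.
  have : 'C(m, j)%:R != 0 :> K by rewrite pnatr_eq0 -lt0n bin_gt0.
  by move=> *; field; do !(apply/andP; split).
rewrite -sumrB (bigD1 (Ordinal N1)) //= [X in _ + X]big1 ?addr0 => [|n n1].
  by rewrite (inner 1%N) hornerZ /= factS fact0 muln1 !divr1 mulrDl mul1r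
    addrAC subrr add0r.
rewrite inner hornerZ (_ : (n == 1 :> nat)%N = false) ?addr0 ?subrr //.
exact/negbTE.
Qed.

Definition poly_primitive p : {poly K} :=
  \poly_(i < (size p).+1) (p`_i.-1 / i%:R *+ (0 < i)%N).

Lemma deriv_poly_primitive p : (poly_primitive p)^`() = p.
Proof.
apply/polyP => i; rewrite coef_deriv coef_poly ltnS /=.
case: ltnP => [_|pi]; last by rewrite mul0rn nth_default.
by rewrite mulr1n -[_ *+ i.+1]mulr_natr divfK ?pnatr_eq0.
Qed.

Lemma poly_primitive0 p : (poly_primitive p).[0] = 0.
Proof. by rewrite horner_coef0 coef_poly. Qed.

Lemma derivn_poly_primitive p n : (0 < n)%N ->
  (poly_primitive p)^`(n) = p^`(n - 1).
Proof.
by case: n => // n _; rewrite subn1 derivSn deriv_poly_primitive.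
Qed.

Lemma big_ord_double_even (F : nat -> K) M :
  (forall j, odd j -> (1 < j)%N -> F j = 0) -> (0 < M)%N ->
  \sum_(j < 2 * M) F j = F 0%N + F 1%N + \sum_(1 <= m < M) F (2 * m)%N.
Proof.
move=> Fodd; case: M => // M _; elim: M => [|M IH].
  by rewrite big_geq // !big_ord_recr big_ord0 /= add0r addr0.
have -> : (2 * M.+2 = (2 * M.+1).+2)%N by rewrite !mul2n.
have step n : \sum_(j < n.+2) F j = \sum_(j < n) F j + F n + F n.+1.
  by rewrite 2!big_ord_recr.
rewrite step IH [in RHS]big_nat_recr // [F (2 * M.+1).+1]Fodd ?addr0 ?addrA //.
by rewrite mul2n oddS odd_double.
Qed.

(** The even order [2 * M] makes [M] the upper bound of the sum over even Bernoulli numbers, so that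
    it can serve as the index of a partial sum of the series. *)
Definition euler_maclaurin P M : {poly K} :=
  let Q := bernoulli_operator (2 * M) (poly_primitive P) + P in
  Q - Q.[0]%:P.

Lemma euler_maclaurin_diff P M z : (size P < M)%N ->
  (euler_maclaurin P M).[z + 1] - (euler_maclaurin P M).[z] = P.[z + 1].
Proof.
move=> PM; have M0 : (0 < M)%N by apply: leq_trans PM.
rewrite /euler_maclaurin !(hornerD, hornerN, hornerC).
have := @bernoulli_operator_diff (2 * M) (poly_primitive P) z.
rewrite deriv_poly_primitive => <-; first by ring.
- by case: (M) M0 => // m _; rewrite mulnS.
- apply: (leq_trans (size_poly _ _)).
  by rewrite mul2n -addnn (leq_trans PM) // leq_addr.
Qed.

Lemma horner_euler_maclaurin P M x : (0 < M)%N ->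
  (euler_maclaurin P M).[x] =
    (poly_primitive P).[x] + (P.[x] - P.[0]) / 2
    + \sum_(1 <= m < M) (ratr (B (2 * m)) / ((2 * m)`!)%:R
        * (P^`(2 * m - 1).[x] - P^`(2 * m - 1).[0])).
Proof.
move=> M0; set J := poly_primitive P.
have ev z : (bernoulli_operator (2 * M) J).[z] =
    J.[z] - P.[z] / 2 + \sum_(1 <= m < M) (ratr (B (2 * m)) / ((2 * m)`!)%:R
        * P^`(2 * m - 1).[z]).
  rewrite horner_sum.
  under eq_bigr => j _ do rewrite hornerZ.
  rewrite (big_ord_double_even
    (F := fun j => ratr (B j) / j`!%:R * J^`(j).[z])) //.
    rewrite /= deriv_poly_primitive bernoulli_number1.
    (* $B_0$ gives the primitive and $B_1$ gives $-P/2$, which the summand [P] of [euler_maclaurin]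
       turns into $+P/2$. *)
    congr (_ + _ + _).
    - by rewrite bernoulli_number0 fact0 divr1 rmorph1 mul1r.
    - by rewrite factS fact0 muln1 divr1 rmorphN fmorph_div rmorph1
         rmorph_nat; field.
    - rewrite !big_nat; apply: eq_bigr => m /andP[m0 _].
      by rewrite derivn_poly_primitive // muln_gt0.
  by move=> j jo j1; rewrite bernoulli_number_odd // rmorph0 !mul0r.
rewrite /euler_maclaurin !(hornerD, hornerN, hornerC) !ev poly_primitive0.
under [in RHS]eq_bigr => m _ do rewrite mulrBr.
by rewrite sumrB; field.
Qed.

End EulerMaclaurin.

(** * Existence, uniqueness and translation of summation polynomials *)

Section PolySum.
Variable R : realType.
Local Notation C := (Cplx R).
Implicit Types (p P : {poly C}) (z : C).

(** Two solutions agree at every natural number, by induction from 0, so a nonzero difference would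
    have too many roots. *)
Lemma is_poly_sum_unique p P Q : is_poly_sum p P -> is_poly_sum p Q -> P = Q.
Proof.
move=> [P1 P0] [Q1 Q0]; apply/eqP; rewrite -subr_eq0; apply/negPn/negP => D0.
have rootD (k : nat) : root (P - Q) k%:R.
  apply/rootP; elim: k => [|k]; rewrite !hornerE; first by rewrite P0 Q0 subrr.
  rewrite -natr1 => <-.
  have := P1 (k%:R + 1); rewrite -(Q1 (k%:R + 1)) addrK.
  by move=> /(canRL (subrK _)) ->; ring.
have := @max_poly_roots _ (P - Q) [seq k%:R | k <- iota 0 (size (P - Q))] D0.
rewrite size_map size_iota ltnn => h; apply/notF/h.
  by apply/allP => _ /mapP[k _ ->].
rewrite map_inj_in_uniq ?iota_uniq // => i j _ _.
by move=> /eqP; rewrite eqr_nat => /eqP.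
Qed.

Lemma poly_sumE p P : is_poly_sum p P -> poly_sum p = P.
Proof. by move=> hP; apply: xget_unique => // Q /is_poly_sum_unique; apply. Qed.

(** Besides existence, this shows with uniqueness that the polynomial is the same for all large
    [M]. *)
Lemma is_poly_sum_euler_maclaurin P M : (size P < M)%N ->
  is_poly_sum P (euler_maclaurin P M).
Proof.
move=> PM; split=> [z|]; last first.
  by rewrite /euler_maclaurin hornerD hornerN hornerC subrr.
by rewrite -{1}(subrK 1 z) (euler_maclaurin_diff _ PM) subrK.
Qed.

Lemma poly_sumP p : is_poly_sum p (poly_sum p).
Proof.
rewrite (poly_sumE (is_poly_sum_euler_maclaurin (ltnSn _))).
exact: is_poly_sum_euler_maclaurin.
Qed.

(** Translation preserves the difference equation; subtracting the value at [c] restores the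
    vanishing at 0. *)
Lemma poly_sum_shift p c :
  poly_sum (p \Po ('X + c%:P)) =
    poly_sum p \Po ('X + c%:P) - (poly_sum p).[c]%:P.
Proof.
have [Sp _] := poly_sumP p.
apply: poly_sumE; split=> [z|]; last first.
  by rewrite !(hornerD, hornerN, hornerC, horner_comp, hornerX) add0r subrr.
rewrite !(hornerD, hornerN, hornerC, horner_comp, hornerX) -Sp.
by rewrite (_ : z - 1 + c = z + c - 1); ring.
Qed.

(** * Fractional sums of polynomials *)

Section FractionalSum.
Variables (U : set (C -> C)) (Sig : (C -> C) -> C -> C -> C).
Hypothesis SigP : is_fractional_sum U Sig.
Hypothesis polyU : @polynomial_functions R `<=` S_span U.

Lemma fractional_sum_poly P x : Sig (horner P) 1 x = (poly_sum P).[x].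
Proof.
have inU p : S_span U (horner p) by apply: polyU; exists p.
have shiftE (c : C) : (fun t : C => P.[t + c]) = horner (P \Po ('X + c%:P)).
  by apply/funext => t; rewrite !(hornerD, hornerC, horner_comp, hornerX).
have [SP SP0] := poly_sumP P.
pose F (z : C) := Sig (horner P) 1 z - (poly_sum P).[z].
(* Chasles at 1, 0, 0 reads $s + s = s$ for the empty sum $s$ from 1 to 0. *)
have F0 : F 0 = 0.
  rewrite /F SP0 subr0; have := frac_sum_chasles SigP (inU P) 1 0 0.
  by rewrite add0r => /eqP; rewrite -subr_eq0 addrK => /eqP.
have F1 z : F (z + 1) = F z.
  rewrite /F -(frac_sum_chasles SigP (inU P) 1 z).
  (* A one-term sum is shifted to run from 1 to 1, where (A4) evaluates it. *)
  have -> : Sig (horner P) (z + 1) (z + 1) = P.[z + 1].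
    rewrite addrC (frac_sum_shift SigP (inU P)) shiftE.
    by rewrite (frac_sum_one SigP (inU _)) -shiftE.
  by rewrite -(SP (z + 1)) addrK; ring.
have Fn z n : F (z + n%:R) = F z.
  by elim: n => [|n IH]; rewrite ?addr0 // -natr1 addrA F1.
(* By shift and Chasles, the quantity that (A6) controls at rank [n] is $F(x + n) - F(n)$, which
   periodicity reduces to $F(x)$. *)
have Fx (n : nat) : Sig (fun t => P.[t + n%:R]) 1 x -
    poly_frac_sum (P \Po ('X + (n%:R)%:P)) 1 x = F x.
  rewrite -(frac_sum_shift SigP (inU P)) /poly_frac_sum poly_sum_shift.
  rewrite !(hornerD, hornerN, hornerC, horner_comp, hornerX).
  have := frac_sum_chasles SigP (inU P) 1 n%:R (x + n%:R).
  rewrite (addrC n%:R) => /(canRL (addKr _)) ->.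
  have := Fn 0 n; rewrite F0 add0r => /eqP; rewrite subr_eq0 => /eqP ->.
  by rewrite -(Fn x n) /F subrr add0r; ring.
(* With the constant sequence [P] as approximants, (A6) says that the constant sequence [F x] tends
   to 0. *)
have := frac_sum_asympt SigP (inU P) (fun=> erefl (size P)) _ 1 x.
under eq_cvg do rewrite Fx.
move=> /(_ _)/(cvg_unique (@norm_hausdorff _ C) (cvg_cst (F x))) Fx0.
apply/eqP; rewrite -subr_eq0; apply/eqP/Fx0 => t.
by under eq_cvg do rewrite subrr normr0; exact: cvg_cst.
Qed.

End FractionalSum.

(** * Integration of polynomials along a segment *)

Lemma Rintegral_deriv_horner (q : {poly R}) (a b : R) : a < b ->
  (\int[lebesgue_measure]_(t in `[a, b]) q^`().[t])%R = q.[b] - q.[a].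
Proof.
move=> ab; rewrite /Rintegral (@continuous_FTC2 _ _ (horner q)) //.
- exact/continuous_subspaceT/continuous_horner.
- split=> [t _||]; first exact: derivable_horner.
  + by apply: cvg_at_right_filter; exact: continuous_horner.
  + by apply: cvg_at_left_filter; exact: continuous_horner.
- by move=> t _; rewrite derivE.
Qed.

(** Meant for [phi] the real or imaginary part: at real arguments it can be moved onto the
    coefficients, and the fundamental theorem of calculus applies to the resulting real
    polynomial. *)
Lemma Rintegral_real_linear_deriv (phi : C -> R) (G : {poly C}) :
  {morph phi : a b / a + b} ->
  (forall a (t : R), phi (a * (t%:C)%C) = phi a * t) ->
  (\int[lebesgue_measure]_(t in `[0%R, 1%R]) phi G^`().[(t%:C)%C])%R
    = phi G.[1] - phi G.[0].
Proof.
move=> phiD phiZ.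
have phi0 : phi 0 = 0 by rewrite -[X in phi X](mul0r ((0 : R)%:C)%C) phiZ mulr0.
have phiE (p : {poly C}) (t : R) : phi p.[(t%:C)%C] = (map_poly phi p).[t].
  rewrite horner_coef (big_morph phi phiD phi0) /map_poly horner_poly.
  by apply: eq_bigr => i _; rewrite -phiZ -rmorphXn.
have phi' : (map_poly phi G)^`() = map_poly phi G^`().
  apply/polyP => i; rewrite coef_map_id0 // !coef_deriv coef_map_id0 //.
  by rewrite -mulr_natr -[in RHS]mulr_natr -(rmorph_nat (real_complex R)) phiZ.
under eq_Rintegral => t _ do rewrite phiE -phi'.
by rewrite Rintegral_deriv_horner ?ltr01 // -!phiE.
Qed.

(** With $J$ the primitive and $G(t) = J(t x)$, the chain rule makes the integrand $G'(t)$. *)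
Lemma segment_integral_poly P x :
  segment_integral (horner P) 0 x = (poly_primitive P).[x].
Proof.
pose G := poly_primitive P \Po (x *: 'X).
have GE (t : R) : P.[0 + (t%:C)%C * (x - 0)] * (x - 0) = G^`().[(t%:C)%C].
  rewrite deriv_comp deriv_poly_primitive derivZ derivX hornerM horner_comp.
  by rewrite !hornerZ hornerX hornerC mulr1 add0r subr0 (mulrC x).
have GEx : G.[1] - G.[0] = (poly_primitive P).[x].
  by rewrite !horner_comp !hornerZ !hornerX mulr1 mulr0 poly_primitive0 subr0.
rewrite /segment_integral.
under eq_Rintegral => t _ do rewrite GE.
under [X in (_ +i* X)%C]eq_Rintegral => t _ do rewrite GE.
rewrite !Rintegral_real_linear_deriv
  => [|[a b] [c d]|[a b] t|[a b] [c d]|[a b] t] //=.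
- by rewrite -GEx; case: G.[1] => a b; case: G.[0] => c d.
- by rewrite mulr0 add0r mulrC.
- by rewrite mulr0 subr0.
Qed.

End PolySum.

Theorem theorem5p2p1 (R : realType) (U : set (Cplx R -> Cplx R))
    (Sig : (Cplx R -> Cplx R) -> Cplx R -> Cplx R -> Cplx R)
    (P : {poly Cplx R}) (x : Cplx R) :
  summable_set U ->
  is_fractional_sum U Sig ->
  @polynomial_functions R `<=` S_span U ->
  let term (m : nat) : Cplx R :=
    ratr (bernoulli_number (2 * m)) / ((2 * m)`!)%:R
      * (P^`(2 * m - 1).[x] - P^`(2 * m - 1).[0]) in
  cvgn (fun n : nat => \sum_(1 <= m < n) term m) /\
  Sig (horner P) 1 x =
    segment_integral (horner P) 0 x + (P.[x] - P.[0]) / 2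
      + \big[+%R/0]_(1 <= m <oo) term m.
Proof.
move=> _ SigP polyU term; rewrite segment_integral_poly.
rewrite (fractional_sum_poly SigP polyU).
set c := (poly_primitive P).[x] + (P.[x] - P.[0]) / 2.
(* Once [n] exceeds [size P], it can itself be taken as the order [M], so the partial sums are
   stationary. *)
have termE : \forall n \near \oo,
    \sum_(1 <= m < n) term m = (poly_sum P).[x] - c.
  exists (size P).+1 => // n /= Pn.
  rewrite (poly_sumE (is_poly_sum_euler_maclaurin Pn)).
  by rewrite horner_euler_maclaurin ?(leq_trans _ Pn) // addrAC subrr add0r.
split; first exact: is_cvg_near_cst termE.
by rewrite (lim_near_cst (@norm_hausdorff _ _) termE) addrC subrK.
Qed.
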